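(* If $G$ is a resistant group and $A$ a torsion-free abelian group, then $G\times A$ is again resistant. More generally, this is true with ''resistant'' replaced by ''$\mathcal{K}$-resistant'' for any class $\mathcal{K}$ of fields closed under passing to extension fields: if $G$ is $\mathcal{K}$-resistant and $A$ is a torsion-free abelian group, then $G\times A$ is $\mathcal{K}$-resistant.
   Context: For a field $k$, a group $G$ is called $k$-resistant if for every $r$ in the group algebra $k\,G$ with support (set of group elements having nonzero coefficient) of cardinality $>1$, the two-sided ideal of $k\,G$ generated by $r$ is proper. For a class $\mathcal{K}$ of fields, $G$ is $\mathcal{K}$-resistant if it is $k$-resistant for all $k\in\mathcal{K}$. A group is resistant if it is $k$-resistant for every field $k$. *)

(* Defs.v *)
(* A [groupType] is a possibly infinite group; [msupp r] is the support of the
   finitely supported function [r : {malg k[G]}]. *)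
From HB Require Import structures.
From mathcomp Require Import all_boot all_order all_algebra.
From mathcomp Require Import finmap.
From mathcomp Require Import monalg.

Set Implicit Arguments.
Unset Strict Implicit.
Unset Printing Implicit Defensive.

Import GRing.Theory.

Local Open Scope ring_scope.

(* [{malg k[G]}] is the free k-module on G.  The library makes it a ring only
   for a [monomType], whose axioms exclude nontrivial groups, so the convolution
   product is put here on an alias. *)
Definition group_algebra (k : fieldType) (G : groupType) : Type := {malg k[G]}.

Section GroupAlgebra.
Variables (k : fieldType) (G : groupType).

Local Notation kG := (group_algebra k G).

HB.instance Definition _ := GRing.Lmodule.copy kG {malg k[G]}.

Implicit Types (r s t : kG) (x y : G).

Definition ga_one : kG := << 1%g : G >>.

Definition ga_mul r s : kG :=
  \sum_(x <- msupp r) \sum_(y <- msupp s) << r@_x * s@_y *g (x * y)%g >>.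

Lemma ga_mulw (d1 d2 : {fset G}) r s :
  (msupp r `<=` d1)%fset -> (msupp s `<=` d2)%fset ->
  ga_mul r s = \sum_(x <- d1) \sum_(y <- d2) << r@_x * s@_y *g (x * y)%g >>.
Proof.
move=> le_d1 le_d2; rewrite /ga_mul (big_fset_incl _ le_d1) /=.
  apply/eq_bigr=> x _; apply/big_fset_incl => // y _ /mcoeff_outdom ->.
  by rewrite mulr0 monalgU0.
move=> x _ /mcoeff_outdom rx0.
by rewrite big1 // => y _; rewrite rx0 mul0r monalgU0.
Qed.

Lemma ga_mulUU (a b : k) x y :
  ga_mul << a *g x >> << b *g y >> = << a * b *g (x * y)%g >>.
Proof. by rewrite (ga_mulw msuppU_le msuppU_le) !big_seq_fset1 !mcoeffUU. Qed.

Lemma ga_mulDl : left_distributive ga_mul +%R.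
Proof.
move=> r1 r2 s.
rewrite (ga_mulw (msuppD_le r1 r2) (fsubset_refl (msupp s))).
rewrite (ga_mulw (fsubsetUl (msupp r1) (msupp r2)) (fsubset_refl (msupp s))).
rewrite (ga_mulw (fsubsetUr (msupp r1) (msupp r2)) (fsubset_refl (msupp s))).
rewrite -big_split /=; apply/eq_bigr=> x _.
rewrite -big_split /=; apply/eq_bigr=> y _.
by rewrite mcoeffD mulrDl monalgUD.
Qed.

Lemma ga_mulDr : right_distributive ga_mul +%R.
Proof.
move=> r s1 s2.
rewrite (ga_mulw (fsubset_refl (msupp r)) (msuppD_le s1 s2)).
rewrite (ga_mulw (fsubset_refl (msupp r)) (fsubsetUl (msupp s1) (msupp s2))).
rewrite (ga_mulw (fsubset_refl (msupp r)) (fsubsetUr (msupp s1) (msupp s2))).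
rewrite -big_split /=; apply/eq_bigr=> x _.
rewrite -big_split /=; apply/eq_bigr=> y _.
by rewrite mcoeffD mulrDr monalgUD.
Qed.

Lemma ga_mul0r : left_zero (0 : kG) ga_mul.
Proof. by move=> s; rewrite /ga_mul msupp0 big_seq_fset0. Qed.

Lemma ga_mulr0 : right_zero (0 : kG) ga_mul.
Proof.
by move=> r; rewrite /ga_mul big1 // => x _; rewrite msupp0 big_seq_fset0.
Qed.

Lemma ga_mul_suml (I : Type) (d : seq I) (F : I -> kG) s :
  ga_mul (\sum_(i <- d) F i) s = \sum_(i <- d) ga_mul (F i) s.
Proof. exact: (big_morph (ga_mul^~ s) (fun _ _ => ga_mulDl _ _ _) (ga_mul0r s)). Qed.

Lemma ga_mul_sumr (I : Type) (d : seq I) (F : I -> kG) r :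
  ga_mul r (\sum_(i <- d) F i) = \sum_(i <- d) ga_mul r (F i).
Proof. exact: (big_morph (ga_mul r) (fun _ _ => ga_mulDr _ _ _) (ga_mulr0 r)). Qed.

Lemma ga_mul1r : left_id ga_one ga_mul.
Proof.
move=> s; rewrite [in LHS](monalgE s) ga_mul_sumr [RHS]monalgE.
by apply/eq_bigr=> y _; rewrite ga_mulUU mul1r mul1g.
Qed.

Lemma ga_mulr1 : right_id ga_one ga_mul.
Proof.
move=> r; rewrite [in LHS](monalgE r) ga_mul_suml [RHS]monalgE.
by apply/eq_bigr=> x _; rewrite ga_mulUU mulr1 mulg1.
Qed.

Lemma ga_mulA : associative ga_mul.
Proof.
move: ga_mul ga_mul_suml ga_mul_sumr ga_mulUU => mul mul_suml mul_sumr mulUU.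
move=> r s t; rewrite (monalgE r) (monalgE s).
rewrite !mul_suml; apply/eq_bigr=> x _.
rewrite !(mul_suml, mul_sumr); apply/eq_bigr=> y _.
rewrite (monalgE t) !mul_sumr; apply/eq_bigr=> z _.
by rewrite !mulUU mulrA mulgA.
Qed.

Lemma ga_oner_neq0 : ga_one != 0.
Proof. by rewrite monalgU_eq0 oner_eq0. Qed.

HB.instance Definition _ := GRing.Zmodule_isNzRing.Build kG
  ga_mulA ga_mul1r ga_mulr1 ga_mulDl ga_mulDr ga_oner_neq0.

Lemma ga_scalel (a : k) r : a *: r = (<< a *g (1%g : G) >> : kG) * r.
Proof.
transitivity (\sum_(x <- msupp r) << a * r@_x *g x >> : kG) => //.
rewrite [in RHS](monalgE r) [RHS]ga_mul_sumr.
by apply/eq_bigr=> x _; rewrite ga_mulUU mul1g.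
Qed.

Lemma ga_scaler (a : k) r : a *: r = r * (<< a *g (1%g : G) >> : kG).
Proof.
transitivity (\sum_(x <- msupp r) << a * r@_x *g x >> : kG) => //.
rewrite [in RHS](monalgE r) [RHS]ga_mul_suml.
by apply/eq_bigr=> x _; rewrite ga_mulUU mulg1 mulrC.
Qed.

Lemma ga_scaleAl (a : k) r s : a *: (r * s) = (a *: r) * s.
Proof. by rewrite !ga_scalel mulrA. Qed.

HB.instance Definition _ := GRing.Lmodule_isLalgebra.Build k kG ga_scaleAl.

Lemma ga_scaleAr (a : k) r s : a *: (r * s) = r * (a *: s).
Proof. by rewrite !ga_scaler mulrA. Qed.

HB.instance Definition _ := GRing.Lalgebra_isAlgebra.Build k kG ga_scaleAr.

End GroupAlgebra.

Section Ideals.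
Variable R : nzRingType.

Definition two_sided_ideal (I : R -> Prop) : Prop :=
  [/\ I 0,
      forall u v, I u -> I v -> I (u - v),
      forall a u, I u -> I (a * u)
    & forall a u, I u -> I (u * a)].

Definition ideal_generated_by (r : R) : R -> Prop :=
  fun u => forall I : R -> Prop, two_sided_ideal I -> I r -> I u.

Definition proper (I : R -> Prop) : Prop := exists u, ~ I u.

End Ideals.

Definition resistant_over (k : fieldType) (G : groupType) : Prop :=
  forall r : group_algebra k G,
    (1 < #|` msupp r|)%N -> proper (ideal_generated_by r).

Definition class_resistant (K : fieldType -> Prop) (G : groupType) : Prop :=
  forall k : fieldType, K k -> resistant_over k G.

Definition resistant (G : groupType) : Prop :=
  forall k : fieldType, resistant_over k G.

(* A field extension L/k is a field morphism k -> L; in particular such a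
   class is closed under isomorphism. *)
Definition extension_closed (K : fieldType -> Prop) : Prop :=
  forall (k L : fieldType) (f : {rmorphism k -> L}), K k -> K L.

Definition abelian_group (A : groupType) : Prop :=
  forall a b : A, commute a b.

Definition torsion_free (A : groupType) : Prop :=
  forall (a : A) (n : nat), (0 < n)%N -> (a ^+ n)%g = 1%g -> a = 1%g.

(* Main.v *)
From HB Require Import structures.
From mathcomp Require Import all_boot all_order all_algebra.
From mathcomp Require Import finmap monalg.
From mathcomp Require Import boolp classical_sets.
Require Import Defs.

(** Write A additively ordered: a torsion-free abelian group carries a total
    translation-invariant order [total_cone_exists].  In a product of two
    elements of kA the product of the two largest monomials cannot be cancelled
    [mcoeff_gaM_max].  Hence kA is an integral domain [ga_mul_eq0], and, looking
    also at the smallest monomials, its units are the nonzero multiples of group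
    elements [ga_unit_msupp].  In particular A itself is resistant over every
    field [torsion_free_abelian_resistant]: an element of kA with two monomials
    is not a unit, so its multiples form a proper ideal.

    Let L be the fraction field of kA, an extension of k.  Let r be an element of
    k(G x A) with at least two monomials.  There are two ring morphisms out of
    k(G x A): [project1], to LG, obtained by reading k(G x A) as (kA)G inside LG,
    and [project2], to kA, obtained by killing G.  Properness of a generated
    ideal pulls back along any ring morphism [proper_pullback], so it is enough
    that one image of r has at least two monomials and lives over a group and a
    field for which resistance is known.
    - If the monomials of r have at least two distinct G-components, all these
      components survive in LG since L contains kA [msupp_project1], and
      resistance of G over L applies.
    - Otherwise r is supported on a single coset {g} x A, no two monomials of r
      collide in kA [msupp_project2], and resistance of A over k applies.
    A class of fields closed under extension contains L as soon as it contains k,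
    and the class of all fields is such a class. *)

Set Implicit Arguments.
Unset Strict Implicit.
Unset Printing Implicit Defensive.

Import GRing.Theory.

Local Open Scope ring_scope.

(** * Total orders on torsion-free abelian groups *)

(** The elements at least 1 for a translation-invariant partial order, where x
    precedes y when x^-1 * y lies in P.  Membership of 1 is not part of the
    definition so that the empty set is a cone and Zorn's lemma applies to all
    chains, the empty one included. *)
Definition positive_cone (A : groupType) (P : A -> Prop) : Prop :=
  (forall x y, P x -> P y -> P (x * y)%g) /\
  (forall x, P x -> P x^-1%g -> x = 1%g).

Definition total_cone (A : groupType) (P : A -> Prop) : Prop :=
  positive_cone P /\ forall x, P x \/ P x^-1%g.

Section TotalCone.
Variables (A : groupType) (abA : abelian_group A) (tfA : torsion_free A).

Let mulCg (x y : A) : (x * y)%g = (y * x)%g := abA x y.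

Let mulACg (x y z t : A) : (x * y * (z * t))%g = (x * z * (y * t))%g.
Proof. by rewrite !mulgA -(mulgA x y z) (mulCg y) !mulgA. Qed.

Lemma cone_expg (P : A -> Prop) x n :
  positive_cone P -> P 1%g -> P x -> P (x ^+ n)%g.
Proof.
move=> [PM _] P1 Px; elim: n => [|n IHn]; first by rewrite expg0.
by rewrite expgS; apply: PM.
Qed.

Lemma cone_adjoin1 (P : A -> Prop) :
  positive_cone P -> positive_cone (fun x => P x \/ x = 1%g).
Proof.
case=> [PM Panti]; split=> [x y [Px|->] [Py|->]|x [Px|-> //]].
- by left; apply: PM.
- by rewrite mulg1; left.
- by rewrite mul1g; left.
- by rewrite mul1g; right.
by case=> [|/eqP]; [apply: Panti | rewrite invg_eq1 => /eqP].
Qed.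

(** If x and x^-1 both lie in the cone enlarged by the powers of a, then
    multiplying the two expressions puts a negative power of a in P; so excluding
    these powers keeps the enlarged set a cone. *)
Lemma cone_adjoin (P : A -> Prop) a : positive_cone P -> P 1%g ->
  (forall n, (0 < n)%N -> ~ P (a ^- n)%g) ->
  positive_cone (fun x => exists p n, P p /\ x = (p * a ^+ n)%g).
Proof.
move=> [PM Panti] P1 Pan; split.
  move=> _ _ [p [n [Pp ->]]] [q [m [Pq ->]]].
  exists (p * q)%g, (n + m)%N; split; first exact: PM.
  by rewrite expgnDr mulACg.
move=> _ [p [n [Pp ->]]] [q [m [Pq eq_q]]].
have eq1 : (p * q * a ^+ (n + m) = 1)%g.
  by rewrite expgnDr mulACg -eq_q mulgV.
have eq_pq : (a ^- (n + m) = p * q)%g.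
  by apply/eqP; rewrite eq_sym -mulg_eq1 eq1.
have [nm0|nm_gt0] := posnP (n + m)%N; last first.
  by case: (Pan _ nm_gt0); rewrite eq_pq; apply: PM.
move: nm0 eq1 => /eqP; rewrite addn_eq0 => /andP[/eqP-> /eqP->].
rewrite addn0 expg0 !mulg1 => /eqP; rewrite mulg_eq1 => /eqP eq_p.
by apply: Panti; rewrite // eq_p invgK.
Qed.

(** Take a cone maximal for inclusion.  If neither a nor a^-1 could be added to
    it, it would contain a negative and a positive power of a, hence a common
    power of a together with its inverse; that power is then 1, and so is a. *)
Lemma total_cone_exists : exists P : A -> Prop, total_cone P.
Proof.
have [|P [coneP maxP]] := @Zorn_bigcup A (fun P : set A => positive_cone P).
  move=> F coneF chainF; split.
    move=> x y [X FX Xx] [Y FY Yy].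
    have [XY|YX] := chainF X Y FX FY.
      by exists Y => //; apply: (coneF Y FY).1 => //; apply: XY.
    by exists X => //; apply: (coneF X FX).1 => //; apply: YX.
  move=> x [X FX Xx] [Y FY Yy].
  have [XY|YX] := chainF X Y FX FY.
    by apply: (coneF Y FY).2 => //; apply: XY.
  by apply: (coneF X FX).2 => //; apply: YX.
have {}maxP (Q : set A) : positive_cone Q -> (P `<=` Q)%classic ->
    forall x, Q x -> P x.
  move=> coneQ PQ x Qx; apply: contrapT => Px.
  by apply: (maxP Q) coneQ; split=> // /(_ x Qx).
have P1 : P 1%g.
  by apply: (maxP _ (cone_adjoin1 coneP)) => [y|]; [left | right].
have notP (a : A) : ~ P a -> exists2 n, (0 < n)%N & P (a ^- n)%g.
  move=> Pa; apply: contrapT => noP; apply: Pa.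
  have Pan n : (0 < n)%N -> ~ P (a ^- n)%g.
    by move=> n_gt0 Pn; apply: noP; exists n.
  apply: (maxP _ (cone_adjoin coneP P1 Pan)) => [y Py|].
    by exists y, 0; rewrite expg0 mulg1.
  by exists 1%g, 1; rewrite mul1g expg1.
exists P; split=> // a.
have [Pa|/notP[n n_gt0 Pn]] := pselect (P a); first by left.
have [Pa|/notP[m m_gt0]] := pselect (P a^-1%g); first by right.
rewrite -expVgn invgK => Pm; left.
suff a1 : a = 1%g by rewrite a1.
(* Both a ^+ m and a ^- n lie in P, hence so do a ^+ (m * n) and its inverse. *)
apply: (@tfA a (m * n)%N); first by rewrite muln_gt0 m_gt0 n_gt0.
apply: coneP.2; first by rewrite expgnA; apply: cone_expg.
by rewrite mulnC expgnA -expVgn; apply: cone_expg.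
Qed.

(** Reversing the order turns statements on largest elements into statements on
    smallest ones. *)
Lemma total_cone_inv (P : A -> Prop) :
  total_cone P -> total_cone (fun x => P x^-1%g).
Proof.
case=> [[PM Panti] Ptot]; split; last by move=> x; case: (Ptot x^-1%g); auto.
split=> [x y Px Py|x Px]; first by rewrite invgM mulCg; apply: PM.
by rewrite invgK => Px1; apply: Panti.
Qed.

End TotalCone.

(** * Products in the group algebra of a torsion-free abelian group *)

Lemma total_cone_max (A : groupType) (P : A -> Prop) (s : seq A) (x0 : A) :
  total_cone P -> x0 \in s ->
  exists2 m, m \in s & forall x, x \in s -> P (x^-1 * m)%g.
Proof.
case=> [[PM _] Ptot] x0s.
have P1 : P 1%g by case: (Ptot 1%g); rewrite ?invg1.
have {x0 x0s}: s != [::] by case: s x0s.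
elim: s => // x s IHs _; have [->|s_neq0] := eqVneq s [::].
  exists x; first by rewrite inE.
  by move=> y; rewrite inE => /eqP->; rewrite mulVg.
have [m ms maxm] := IHs s_neq0; case: (Ptot (x^-1 * m)%g) => Pxm.
  exists m; first by rewrite inE ms orbT.
  by move=> y; rewrite inE => /predU1P[->|/maxm].
exists x; first by rewrite inE eqxx.
move=> y; rewrite inE => /predU1P[->|/maxm Pym]; first by rewrite mulVg.
by move: (PM _ _ Pym Pxm); rewrite invgM invgK mulgA mulgK.
Qed.

Section Coefficients.
Variables (k : fieldType) (G : groupType).
Implicit Types r s : group_algebra k G.

Lemma mcoeff_gaM r s z :
  (r * s)@_z =
    \sum_(x <- msupp r) \sum_(y <- msupp s) r@_x * s@_y *+ ((x * y)%g == z).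
Proof.
rewrite [r * s]/(ga_mul r s) /ga_mul raddf_sum; apply: eq_bigr => x _.
by rewrite raddf_sum; apply: eq_bigr => y _; rewrite /= mcoeffU.
Qed.

Lemma mcoeff_gaM_unique r s m n : m \in msupp r -> n \in msupp s ->
  (forall x y, x \in msupp r -> y \in msupp s ->
     (x * y = m * n)%g -> x = m /\ y = n) ->
  (r * s)@_(m * n)%g = r@_m * s@_n.
Proof.
move=> mr ns uniq_mn; rewrite mcoeff_gaM.
rewrite (bigD1_seq m) ?fset_uniq //= (bigD1_seq n) ?fset_uniq //= eqxx mulr1n.
rewrite big_seq_cond big1 ?addr0 => [|y /andP[ys yn]].
  rewrite big_seq_cond big1 ?addr0 // => x /andP[xr xm].
  rewrite big_seq big1 // => y ys; case: eqP => // /(uniq_mn _ _ xr ys)[].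
  by move/eqP: xm.
by case: eqP => // /(uniq_mn _ _ mr ys)[_]; move/eqP: yn.
Qed.

Lemma msupp_neq0 r : r != 0 -> exists x, x \in msupp r.
Proof. 
move=> r_neq0; apply/fset0Pn; apply: contraNneq r_neq0 => supp0.
by apply/eqP; rewrite [LHS]monalgE supp0 big_seq_fset0.
Qed.

End Coefficients.

Section Domain.
Variables (k : fieldType) (A : groupType).
Hypotheses (abA : abelian_group A) (tfA : torsion_free A).
Implicit Types r s : group_algebra k A.

(** If x <= m, y <= n and x * y = m * n, then x^-1 * m and y^-1 * n are inverse to
    each other and both at least 1, so x = m and y = n. *)
Lemma mcoeff_gaM_max (P : A -> Prop) r s m n : total_cone P ->
  m \in msupp r -> (forall x, x \in msupp r -> P (x^-1 * m)%g) ->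
  n \in msupp s -> (forall y, y \in msupp s -> P (y^-1 * n)%g) ->
  (r * s)@_(m * n)%g = r@_m * s@_n.
Proof.
case=> [[_ Panti] _] mr maxm ns maxn.
apply: mcoeff_gaM_unique => // x y xr ys eq_xy.
have eq_inv : (x^-1 * m = (y^-1 * n)^-1)%g.
  rewrite invgM invgK; apply: (mulgI x); apply: (mulIg n).
  by rewrite !mulgA mulgV mul1g -eq_xy -!mulgA (abA n^-1%g) -!mulgA mulgV mulg1.
have y_n : (y^-1 * n = 1)%g.
  by apply: Panti; rewrite -?eq_inv; [apply: maxn | apply: maxm].
by move: eq_inv; rewrite y_n invg1 => /eqP; rewrite mulg_eq1 eqg_inv => /eqP->;
   move/eqP: y_n; rewrite mulg_eq1 eqg_inv => /eqP->.
Qed.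

Lemma ga_mulC r s : r * s = s * r.
Proof.
rewrite [LHS]/(ga_mul r s) [RHS]/(ga_mul s r) /ga_mul exchange_big /=.
by apply: eq_bigr => y _; apply: eq_bigr => x _; rewrite mulrC abA.
Qed.

Lemma ga_mul_eq0 r s : r * s = 0 -> (r == 0) || (s == 0).
Proof.
have [P totP] := total_cone_exists abA tfA.
have [//|/msupp_neq0[x xr]] := eqVneq r 0.
have [//|/msupp_neq0[y ys]] := eqVneq s 0.
have [m mr maxm] := total_cone_max totP xr.
have [n ns maxn] := total_cone_max totP ys.
move=> rs0; have /eqP := mcoeff_gaM_max totP mr maxm ns maxn.
rewrite rs0 mcoeff0 eq_sym mulf_eq0 !mcoeff_eq0.
by rewrite mr ns.
Qed.

(** If r * s = 1, the product of the largest monomials and that of the smallest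
    monomials are both 1.  Passing from s to its inverse exchanges largest and
    smallest, so the largest monomial m of r is at most the smallest one m'. *)
Lemma ga_unit_msupp r s : r * s = 1 -> exists a, msupp r = [fset a]%fset.
Proof.
move=> rs1; have [P totP] := total_cone_exists abA tfA.
have totN := total_cone_inv abA totP.
have rs_neq0 : r * s != 0 by rewrite rs1 oner_eq0.
have /msupp_neq0[x xr] : r != 0 by apply: contraNneq rs_neq0 => ->; rewrite mul0r.
have /msupp_neq0[y ys] : s != 0 by apply: contraNneq rs_neq0 => ->; rewrite mulr0.
have extremal Q : total_cone Q -> exists m n, [/\ m \in msupp r,
    (forall x, x \in msupp r -> Q (x^-1 * m)%g),
    n \in msupp s, (forall y, y \in msupp s -> Q (y^-1 * n)%g) & m = n^-1%g].
  move=> totQ; have [m mr maxm] := total_cone_max totQ xr.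
  have [n ns maxn] := total_cone_max totQ ys.
  exists m, n; split=> //; apply/eqP; rewrite -mulg_eq1.
  have [//|mn_neq1] := eqVneq (m * n)%g 1%g.
  have /eqP := mcoeff_gaM_max totQ mr maxm ns maxn.
  rewrite rs1 [1]/(ga_one k A) /ga_one mcoeffU [1%g == _]eq_sym (negPf mn_neq1).
  by rewrite eq_sym mulf_eq0 !mcoeff_eq0 mr ns.
have [m [n [mr maxm _ maxn eq_m]]] := extremal _ totP.
have [m' [n' [m'r minm n's _ eq_m']]] := extremal _ totN.
have [[_ Panti] _] := totP.
have eq_mm' : m' = m.
  apply/eqP; rewrite -eqg_inv -mulg_eq1; apply/eqP/Panti; first exact: maxm.
  by rewrite invgM invgK eq_m eq_m' invgK -abA; apply: maxn.
exists m; apply/fsetP=> z; rewrite inE; apply/idP/eqP => [zr|-> //].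
apply/eqP; rewrite -eqg_inv -mulg_eq1; apply/eqP/Panti; first exact: maxm.
by rewrite -eq_mm'; apply: minm.
Qed.

End Domain.

(** * The group algebra as an integral domain *)

Section Fraction.
Variables (k : fieldType) (A : groupType).
Hypotheses (abA : abelian_group A) (tfA : torsion_free A).

(** The type depends on the two hypotheses on A because canonical instances
    cannot otherwise recover them; without them kA need be neither commutative nor
    a domain. *)
Definition ga_domain of abelian_group A & torsion_free A : Type :=
  group_algebra k A.

Local Notation D := (ga_domain abA tfA).

HB.instance Definition _ := GRing.Algebra.copy D (group_algebra k A).

HB.instance Definition _ := GRing.PzRing_hasCommutativeMul.Build D (ga_mulC abA).

(** These are exactly the invertible elements, by [ga_unit_msupp]; stated with
    the support, invertibility is decidable and the inverse explicit. *)
Definition ga_unit : pred D := fun r => #|` msupp r| == 1%N.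

(* On a unit the sum has a single term. *)
Definition ga_inv (r : D) : D :=
  if ga_unit r then
    (\sum_(a <- msupp r) << (r@_a)^-1 *g a^-1%g >> : group_algebra k A)
  else r.

Lemma ga_mulVr : {in ga_unit, left_inverse 1 ga_inv *%R}.
Proof.
move=> r unit_r; have /cardfs1P[a supp_r] : ga_unit r := unit_r.
rewrite /ga_inv ifT //.
have ra_neq0 : r@_a != 0 by rewrite mcoeff_neq0 supp_r fset11.
have def_r : r = << r@_a *g a >> by rewrite [LHS]monalgE supp_r big_seq_fset1.
by rewrite supp_r big_seq_fset1 [X in _ * X]def_r [LHS]ga_mulUU mulVf // mulVg.
Qed.

Lemma ga_unitPl (r s : D) : s * r = 1 -> ga_unit r.
Proof.
by rewrite mulrC => /(ga_unit_msupp abA tfA)[a supp_r]; apply/cardfs1P; exists a.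
Qed.

Lemma ga_invr_out : {in [predC ga_unit], ga_inv =1 id}.
Proof. by move=> r /negPf nunit_r; rewrite /ga_inv ifF. Qed.

HB.instance Definition _ :=
  GRing.ComNzRing_hasMulInverse.Build D ga_mulVr ga_unitPl ga_invr_out.

HB.instance Definition _ :=
  GRing.ComUnitRing_isIntegral.Build D (ga_mul_eq0 abA tfA).

End Fraction.

(** * Pulling back properness along ring morphisms *)

Lemma ideal_generated_two_sided (R : nzRingType) (r : R) :
  two_sided_ideal (ideal_generated_by r).
Proof.
split=> [I [] //|u v Iu Iv I idI Ir|a u Iu I idI Ir|a u Iu I idI Ir].
- by have [_ IB _ _] := idI; apply: IB; [apply: Iu | apply: Iv].
- by have [_ _ IMl _] := idI; apply: IMl; apply: Iu.
by have [_ _ _ IMr] := idI; apply: IMr; apply: Iu.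
Qed.

(** If the ideal of r were everything, it would contain 1; being contained in the
    preimage of the ideal of f r, it would force the latter to contain f 1 = 1. *)
Lemma proper_pullback (R S : nzRingType) (f : {rmorphism R -> S}) (r : R) :
  proper (ideal_generated_by (f r)) -> proper (ideal_generated_by r).
Proof.
have [I0 IB IMl IMr] := ideal_generated_two_sided (f r).
case=> u Iu; exists 1 => gen1; apply: Iu; rewrite -[u]mulr1; apply: (IMl).
rewrite -(rmorph1 f).
apply: (gen1 (fun v => ideal_generated_by (f r) (f v))); last by move=> I.
split=> [|v w Iv Iw|a v Iv|a v Iv].
- by rewrite rmorph0.
- by rewrite rmorphB; apply: IB.
- by rewrite rmorphM; apply: IMl.
by rewrite rmorphM; apply: IMr.
Qed.

Section Lift.
Variables (k : fieldType) (G : groupType) (S : nzRingType).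
Variables (f : {rmorphism k -> S}) (h : G -> S).
Hypotheses (h1 : h 1%g = 1) (hM : forall x y, h (x * y)%g = h x * h y).
Hypothesis fhC : forall c x, GRing.comm (f c) (h x).

(** The ring morphism given by the universal property of the group algebra: f on
    scalars, h on group elements.  The three properties of h are arguments so
    that the morphism structure can be attached to the constant. *)
Definition ga_lift of h 1%g = 1 & (forall x y, h (x * y)%g = h x * h y)
    & (forall c x, GRing.comm (f c) (h x)) : group_algebra k G -> S :=
  mmap f h.

Local Notation lift := (ga_lift h1 hM fhC).

Lemma ga_lift_is_zmod_morphism : zmod_morphism lift.
Proof. exact: (@mmap_is_additive G k S f h). Qed.

HB.instance Definition _ :=
  GRing.isZmodMorphism.Build (group_algebra k G) S lift ga_lift_is_zmod_morphism.

Lemma ga_liftU c x : lift << c *g x >> = f c * h x.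
Proof. exact: mmapU. Qed.

Lemma ga_lift_is_monoid_morphism : monoid_morphism lift.
Proof.
split=> [|r s]; first by rewrite [LHS](ga_liftU 1 1%g) rmorph1 mul1r.
rewrite [r]monalgE [s]monalgE mulr_suml !raddf_sum mulr_suml.
apply: eq_bigr => x _; rewrite mulr_sumr raddf_sum mulr_sumr.
apply: eq_bigr => y _; rewrite /= [_ * _ in LHS]ga_mulUU !ga_liftU rmorphM hM.
by rewrite !mulrA -(mulrA (f _) (f _)) fhC !mulrA.
Qed.

HB.instance Definition _ :=
  GRing.isMonoidMorphism.Build (group_algebra k G) S lift
    ga_lift_is_monoid_morphism.

Lemma proper_mmap r :
  proper (ideal_generated_by (mmap f h r)) ->
  proper (ideal_generated_by (r : group_algebra k G)).
Proof. exact: (@proper_pullback _ _ lift). Qed.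

End Lift.

(** * Resistance *)

Lemma card_msupp_gt1P (k : fieldType) (G : groupType) (r : group_algebra k G) :
  reflect (exists x y, [/\ x \in msupp r, y \in msupp r & x != y])
          (1 < #|` msupp r|)%N.
Proof.
apply: (iffP idP) => [|[x [y [xr yr neq_xy]]]].
  move: (fset_uniq (msupp r)).
  have mem_r z : (z \in msupp r) = (z \in (msupp r : seq G)) by [].
  case: (enum_fset (msupp r)) mem_r => [|x [|y s]] //= mem_r.
  rewrite inE negb_or => /andP[/andP[neq_xy _] _] _.
  by exists x, y; rewrite !mem_r !inE !eqxx orbT.
apply: (@leq_trans #|` [fset x; y]%fset|); first by rewrite cardfs2 neq_xy.
by apply/fsubset_leq_card/fsubsetP => z; rewrite !inE => /orP[]/eqP->.
Qed.

(** The multiples of r form a two-sided ideal because kA is commutative, and it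
    misses 1 because a unit has a single monomial. *)
Lemma torsion_free_abelian_resistant (k : fieldType) (A : groupType) :
  abelian_group A -> torsion_free A -> resistant_over k A.
Proof.
move=> abA tfA r r_gt1; exists 1.
move=> /(_ (fun u => exists v, u = r * v)) [].
- split=> [|_ _ [v ->] [w ->]|a _ [v ->]|a _ [v ->]].
  + by exists 0; rewrite mulr0.
  + by exists (v - w); rewrite mulrBr.
  + by exists (a * v); rewrite (ga_mulC abA a) -mulrA (ga_mulC abA v).
  by exists (v * a); rewrite mulrA.
- by exists 1; rewrite mulr1.
move=> v /esym/(ga_unit_msupp abA tfA)[a supp_r].
by move: r_gt1; rewrite supp_r cardfs1.
Qed.

Lemma ga_scaleU (k : fieldType) (G : groupType) (c d : k) (x : G) :
  c%:A * (<< d *g x >> : group_algebra k G) = << c * d *g x >>.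
Proof. by rewrite mulr_algl ga_scalel [LHS]ga_mulUU mul1g. Qed.

Section Product.
Variables (k : fieldType) (G A : groupType).
Implicit Types r : group_algebra k (G * A)%type.

Definition project2 : group_algebra k (G * A)%type -> group_algebra k A :=
  mmap (in_alg (group_algebra k A)) (fun x : (G * A)%type => << x.2 >>).

Lemma proper_project2 r :
  proper (ideal_generated_by (project2 r)) -> proper (ideal_generated_by r).
Proof.
apply: proper_mmap => // [x y|c x]; first by rewrite [RHS]ga_mulUU mulr1.
by rewrite /GRing.comm mulr_algl mulr_algr.
Qed.

Lemma mcoeff_project2 r a :
  (project2 r)@_a = \sum_(x <- msupp r) r@_x *+ (x.2 == a).
Proof.
rewrite /project2 /mmap raddf_sum; apply: eq_bigr => x _.
by rewrite /= ga_scaleU mulr1 mcoeffU.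
Qed.

(** On a support with constant first component the second projection is
    injective, so that no coefficients are added together. *)
Lemma msupp_project2 r x : x \in msupp r ->
  (forall y, y \in msupp r -> y.1 = x.1) -> x.2 \in msupp (project2 r).
Proof.
move=> xr const1.
rewrite -mcoeff_neq0 mcoeff_project2 (bigD1_seq x) ?fset_uniq //= eqxx.
rewrite big_seq_cond big1 ?addr0 ?mcoeff_neq0 // => y /andP[yr neq_yx].
case: eqP => // y2; case/eqP: neq_yx; apply/eqP.
by rewrite -pair_eqE /= /pair_eq y2 const1 // !eqxx.
Qed.

Hypotheses (abA : abelian_group A) (tfA : torsion_free A).

Local Notation D := (ga_domain k abA tfA).
Local Notation L := {fraction D}.

Definition base_field : {rmorphism k -> L} := @tofrac D \o in_alg D.

Definition project1 : group_algebra k (G * A)%type -> group_algebra L G :=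
  mmap (in_alg (group_algebra L G) \o base_field)
       (fun x : (G * A)%type => << @tofrac D << x.2 >> *g x.1 >>).

Lemma proper_project1 r :
  proper (ideal_generated_by (project1 r)) -> proper (ideal_generated_by r).
Proof.
apply: proper_mmap => // [x y|c x].
  rewrite [RHS]ga_mulUU -rmorphM; congr (<< @tofrac D _ *g _ >>).
  by rewrite [RHS]ga_mulUU mulr1.
by rewrite /GRing.comm mulr_algl mulr_algr.
Qed.

Lemma mcoeff_project1 r g : (project1 r)@_g =
  @tofrac D (\sum_(x <- msupp r) << r@_x *g x.2 >> *+ (x.1 == g)).
Proof.
rewrite /project1 /mmap !raddf_sum; apply: eq_bigr => x _.
rewrite /= ga_scaleU mcoeffU rmorphMn /= -rmorphM.
by rewrite [_ * _]ga_scaleU mulr1.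
Qed.

(** The coefficient at x.1 is an element of kA whose own coefficient at x.2 is
    that of r at x; it is nonzero in kA, hence in the fraction field. *)
Lemma msupp_project1 r x : x \in msupp r -> x.1 \in msupp (project1 r).
Proof.
move=> xr; rewrite -mcoeff_neq0 mcoeff_project1 tofrac_eq0.
apply/negP => /eqP sum0; move: (xr); rewrite -mcoeff_neq0 => /eqP; apply.
transitivity ((0 : {malg k[A]})@_x.2); last exact: mcoeff0.
rewrite -[X in _ = mcoeff _ X]sum0 raddf_sum /= (bigD1_seq x) ?fset_uniq //= eqxx.
rewrite mulr1n mcoeffUU big1 ?addr0 // => y neq_yx; rewrite mcoeffMn mcoeffU.
case: eqP => // y1; case: eqP => // y2; case/eqP: neq_yx; apply/eqP.
by rewrite -pair_eqE /= /pair_eq y1 y2 !eqxx.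
Qed.

End Product.

Theorem proposition20 (G A : groupType)
    (abA : abelian_group A) (tfA : torsion_free A) :
  (resistant G -> resistant (G * A)%type) /\
  (forall K : fieldType -> Prop, extension_closed K ->
     class_resistant K G -> class_resistant K (G * A)%type).
Proof.
suff resistantM (k : fieldType) :
    resistant_over {fraction (ga_domain k abA tfA)} G ->
  resistant_over k (G * A)%type.
  split=> [resG k|K extK resG k Kk]; apply: (resistantM k); apply: resG.
  exact: (extK k _ (base_field k abA tfA) Kk).
move=> resG r r_gt1.
have [/allP const|] := boolP (all2rel (fun x y => x.1 == y.1) (msupp r)).
  have {}const x y : x \in msupp r -> y \in msupp r -> y.1 = x.1.
    by move=> xr yr; rewrite (eqP (allP (const x xr) y yr)).
  have /card_msupp_gt1P[x [y [xr yr neq_xy]]] := r_gt1.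
  apply: proper_project2; apply: torsion_free_abelian_resistant => //.
  apply/card_msupp_gt1P; exists x.2, y.2; split.
  - by apply: msupp_project2 => // z; apply: const.
  - by apply: msupp_project2 => // z; apply: const.
  apply: contraNneq neq_xy => eq2.
  by rewrite -pair_eqE /pair_eq eq2 (const x y) ?eqxx.
move=> /allPn[x xr /allPn[y yr neq1]].
apply: proper_project1; apply: resG; apply/card_msupp_gt1P.
by exists x.1, y.1; split; rewrite ?msupp_project1.
Qed.
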